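(* For any set $X$, the quotient map $\pi:\mathrm{Path}(X)\to\mathrm{Path}_\sim(X)$, $p\mapsto[p]_\sim$, is order preserving. Consequently $\pi$ is Borel measurable, where $\mathrm{Path}(X)$ and $\mathrm{Path}_\sim(X)$ carry the Borel $\sigma$-algebras of their Alexandroff topologies.
   Context: Fix a set $A$, $\tau\notin A$, $A_\tau=A\cup\{\tau\}$, $A_\tau^*$ the finite words, $\epsilon$ the empty word, ${\downarrow}\sigma$ the set of prefixes of $\sigma$. A path on $X$ is a function $p$ into $X$ with domain ${\downarrow}\sigma$ for some $\sigma\in A_\tau^*$; $\mathrm{Path}(X)$ is the set of paths, ordered by $p\preceq q$ iff $\mathrm{dom}\,p\subseteq\mathrm{dom}\,q$ and $q$ agrees with $p$ on $\mathrm{dom}\,p$. The stutter basis of $p$ is the unique $\phi:\mathrm{dom}\,p\to A_\tau^*$ with $\phi(\epsilon)=\epsilon$; $\phi(\sigma'\tau)=\phi(\sigma')$ if $p(\sigma'\tau)=p(\sigma')$; $\phi(\sigma'\tau)=\phi(\sigma')\tau$ if $p(\sigma'\tau)\ne p(\sigma')$; $\phi(\sigma'a)=\phi(\sigma')a$ for $a\in A$. $\mathrm{st}(p)$ is the path with domain $\phi(\mathrm{dom}\,p)$ with $\mathrm{st}(p)\circ\phi=p$; $p\sim q$ iff $\mathrm{st}(p)=\mathrm{st}(q)$; $\mathrm{Path}_\sim(X)=\mathrm{Path}(X)/{\sim}$, ordered by $[p]\preceq[q]$ iff $\mathrm{st}(p)\preceq\mathrm{st}(q)$. The Alexandroff topology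 of a poset has as open sets exactly the upward closed subsets. *)

(* Defs.v *)
From HB Require Import structures.
From mathcomp Require Import all_boot all_order.
From mathcomp Require Import boolp classical_sets functions.
From mathcomp Require Import topology_structure measurable_structure.
From mathcomp Require Import measurable_function.

Set Implicit Arguments.
Unset Strict Implicit.
Unset Printing Implicit Defensive.

Import Order.TTheory.

Local Open Scope classical_set_scope.
Local Open Scope order_scope.
Local Open Scope quotient_scope.

Definition alexandroff d (P : porderType d) : Type := P.

Section Alexandroff.
Context d (P : porderType d).

HB.instance Definition _ := Choice.on (alexandroff P).

Definition upward_closed (U : set P) : Prop :=
  forall x y : P, x <= y -> U x -> U y.

Lemma upward_closedT : upward_closed setT. Proof. by []. Qed.

Lemma upward_closedI : setI_closed upward_closed.
Proof.
by move=> U V uU uV x y lexy [Ux Vx]; split; [exact: uU Ux|exact: uV Vx].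
Qed.

Lemma upward_closed_bigcup (I : Type) (f : I -> set P) :
  (forall i, upward_closed (f i)) -> upward_closed (\bigcup_i f i).
Proof. by move=> uf x y lexy [i _ fix_]; exists i => //; exact: uf fix_. Qed.

HB.instance Definition _ := isOpenTopological.Build (alexandroff P)
  upward_closedT upward_closedI upward_closed_bigcup.

Lemma alexandroff_openE : @open (alexandroff P) = upward_closed.
Proof. by []. Qed.

End Alexandroff.

Definition borel (T : topologicalType) : set_system T := <<s @open T >>.

(* The measurable types of the library are pointed, whereas a space of paths
   may be empty; measurability is therefore stated on the sigma-algebras
   themselves. It agrees with [measurable_fun] on pointed spaces, see
   [borel_measurableE]. *)
Definition borel_measurable (T U : topologicalType) (f : T -> U) : Prop :=
  forall B : set U, borel B -> borel (f @^-1` B).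

Lemma borel_measurableE (T U : ptopologicalType) (f : T -> U) :
  borel_measurable f <->
  measurable_fun setT (f : g_sigma_algebraType (@open T) ->
                           g_sigma_algebraType (@open U)).
Proof.
split=> [mf _ B mB|mf B mB]; first by rewrite setTI; exact: mf.
by rewrite -[f @^-1` B]setTI; exact: mf.
Qed.

(* The letter tau is [None]; the letters of A are the [Some a]. *)
Definition word (A : Type) : Type := seq (option A).

Definition prefixes (A : Type) (s : word A) : set (word A) :=
  [set w | exists u, s = w ++ u].

(* A path is a partial function, undefined where it takes the value [None]. *)
Definition pdom (A X : Type) (f : word A -> option X) : set (word A) :=
  [set w | f w].

Record Path (A X : Type) : Type := MkPath {
  path_fun :> word A -> option X;
  path_domP : exists s : word A, pdom path_fun = prefixes s }.

Fact path_display : Order.disp_t. Proof. exact: Order.Disp tt tt. Qed.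

Section PathOrder.
Context (A X : Type).
Implicit Types p q : Path A X.

HB.instance Definition _ := gen_eqMixin (Path A X).
HB.instance Definition _ := gen_choiceMixin (Path A X).

Lemma path_ext p q : (forall w, p w = q w) -> p = q.
Proof.
case: p q => [f fP] [g gP] /= /funext efg; rewrite -{}efg in gP *.
by rewrite (Prop_irrelevance fP gP).
Qed.

Definition path_prec p q : Prop :=
  pdom p `<=` pdom q /\ forall w, pdom p w -> q w = p w.

Definition path_le p q : bool := `[< path_prec p q >].

Lemma path_le_refl : reflexive path_le.
Proof. by move=> p; apply/asboolP; split. Qed.

Lemma path_le_anti : antisymmetric path_le.
Proof.
move=> p q /andP[/asboolP[_ pq] /asboolP[qp _]]; apply: path_ext => w.
have [/pq //|np] := pselect (pdom p w).
have nq : ~ pdom q w by move/qp.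
by move: np nq; rewrite /pdom /=; case: (p w) (q w) => [x|] [y|] // [].
Qed.

Lemma path_le_trans : transitive path_le.
Proof.
move=> q p r /asboolP[dpq epq] /asboolP[dqr eqr]; apply/asboolP.
split=> [|w pw]; first exact: subset_trans dqr.
by rewrite eqr ?epq //; exact: dpq.
Qed.

HB.instance Definition _ := Order.Le_isPOrder.Build path_display
  (Path A X) path_le_refl path_le_anti path_le_trans.

Lemma path_leP p q : reflect (path_prec p q) (p <= q).
Proof. exact: asboolP. Qed.

End PathOrder.

Section Stutter.
Context (A X : Type).
Implicit Types (p q : Path A X) (s w : word A).

(* Recursion on the reversed word, so as to peel off the last letter. *)
Fixpoint stutter_basis_rev p (r : word A) : word A :=
  match r with
  | [::] => [::]
  | Some a :: r' => rcons (stutter_basis_rev p r') (Some a)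
  | None :: r' =>
      if `[< p (rcons (rev r') None) = p (rev r') >]
      then stutter_basis_rev p r'
      else rcons (stutter_basis_rev p r') None
  end.

(* Only the values on [pdom p] are meaningful. *)
Definition stutter_basis p s : word A := stutter_basis_rev p (rev s).

Lemma stutter_basis0 p : stutter_basis p [::] = [::].
Proof. by []. Qed.

Lemma stutter_basis_tau_eq p s :
  p (rcons s None) = p s ->
  stutter_basis p (rcons s None) = stutter_basis p s.
Proof. by move=> e; rewrite /stutter_basis rev_rcons /= revK asboolT. Qed.

Lemma stutter_basis_tau_neq p s :
  p (rcons s None) <> p s ->
  stutter_basis p (rcons s None) = rcons (stutter_basis p s) None.
Proof. by move=> e; rewrite /stutter_basis rev_rcons /= revK asboolF. Qed.

Lemma stutter_basis_act p s (a : A) :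
  stutter_basis p (rcons s (Some a)) = rcons (stutter_basis p s) (Some a).
Proof. by rewrite /stutter_basis rev_rcons. Qed.

Lemma stutter_basis_unique p (phi : word A -> word A) :
  phi [::] = [::] ->
  (forall s, pdom p (rcons s None) -> p (rcons s None) = p s ->
     phi (rcons s None) = phi s) ->
  (forall s, pdom p (rcons s None) -> p (rcons s None) <> p s ->
     phi (rcons s None) = rcons (phi s) None) ->
  (forall s a, pdom p (rcons s (Some a)) ->
     phi (rcons s (Some a)) = rcons (phi s) (Some a)) ->
  forall s, pdom p s -> phi s = stutter_basis p s.
Proof.
move=> phi0 phiE phiN phiA; elim/last_ind=> [//|s x IHs] psx.
have {}IHs : phi s = stutter_basis p s.
  apply: IHs; move: psx; have [t ->] := path_domP p => -[u ->].
  by exists (x :: u); rewrite cat_rcons.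
case: x psx => [a|] psx; first by rewrite phiA // stutter_basis_act IHs.
have [e|ne] := pselect (p (rcons s None) = p s).
  by rewrite phiE // stutter_basis_tau_eq.
by rewrite phiN // stutter_basis_tau_neq // IHs.
Qed.

Lemma stutter_basis_rcons p s x :
  (stutter_basis p (rcons s x) = stutter_basis p s /\ p (rcons s x) = p s) \/
  stutter_basis p (rcons s x) = rcons (stutter_basis p s) x.
Proof.
case: x => [a|]; first by right; rewrite stutter_basis_act.
have [e|ne] := pselect (p (rcons s None) = p s).
  by left; rewrite stutter_basis_tau_eq.
by right; rewrite stutter_basis_tau_neq.
Qed.

Lemma prefixes_rcons s x :
  prefixes (rcons s x) = prefixes s `|` [set rcons s x].
Proof.
apply/seteqP; split=> w /=.
  case=> u; case/lastP: u => [|u y]; first by rewrite cats0 => ->; right.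
  by rewrite -rcons_cat => /rcons_inj[-> _]; left; exists u.
move=> [[u ->]|->]; last by exists [::]; rewrite cats0.
by exists (rcons u x); rewrite rcons_cat.
Qed.

Lemma stutter_basis_prefixes p s :
  stutter_basis p @` prefixes s = prefixes (stutter_basis p s).
Proof.
elim/last_ind: s => [|s x IHs].
  have -> : prefixes [::] = [set [::] : word A].
    apply/seteqP; split=> [w [u]|_ ->]; last by exists [::].
    by case: w.
  by rewrite image_set1.
rewrite prefixes_rcons image_setU image_set1 IHs.
have [[-> _]|->] := stutter_basis_rcons p s x; last by rewrite prefixes_rcons.
by apply/setUidPl => _ ->; exists [::]; rewrite cats0.
Qed.

Lemma stutter_basis_cat p s u :
  (size (stutter_basis p s) <= size (stutter_basis p (s ++ u)))%N /\
  (stutter_basis p (s ++ u) = stutter_basis p s -> p (s ++ u) = p s).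
Proof.
elim/last_ind: u => [|u x [les IHu]]; first by rewrite cats0.
rewrite -rcons_cat; have [[-> ->]//|->] := stutter_basis_rcons p (s ++ u) x.
split=> [|e]; first by rewrite size_rcons leqW.
by move: les; rewrite -e size_rcons ltnn.
Qed.

Lemma prefixes_total (t s w : word A) : prefixes t s -> prefixes t w ->
  prefixes s w \/ prefixes w s.
Proof.
move=> [u ->]; elim: s w => [|x s IHs] [|y w].
- by left; exists [::].
- by right; exists (y :: w).
- by left; exists (x :: s).
- case=> v [<- /(fun e => IHs w (ex_intro _ v e))].
  by case=> -[z ->]; [left|right]; exists z.
Qed.

Lemma stutter_basis_eq p s w : pdom p s -> pdom p w ->
  stutter_basis p s = stutter_basis p w -> p s = p w.
Proof.
have [t ->] := path_domP p => ts tw e.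
have [[u su]|[u wu]] := prefixes_total ts tw.
  by rewrite su; apply: (stutter_basis_cat p w u).2; rewrite -su.
by rewrite wu; apply/esym/(stutter_basis_cat p s u).2; rewrite -wu.
Qed.

Definition is_st p q : Prop :=
  pdom q = stutter_basis p @` pdom p /\
  forall s, pdom p s -> q (stutter_basis p s) = p s.

Lemma is_st_exists p : exists q, is_st p q.
Proof.
pose D w s := pdom p s /\ stutter_basis p s = w.
pose f w : option X :=
  if pselect (exists s, D w s) is left h then p (projT1 (cid h)) else None.
have fE s : pdom p s -> f (stutter_basis p s) = p s.
  move=> ps; rewrite /f; case: pselect => [h|[]]; last by exists s.
  by case: cid => /= w [pw e]; exact: stutter_basis_eq.
have fD : pdom f = stutter_basis p @` pdom p.
  apply/seteqP; split=> [w|_ [s ps <-]]; last by rewrite /pdom /= fE.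
  by rewrite /pdom /= /f; case: pselect => // -[s [ps e]] _; exists s.
have [t pt] := path_domP p.
have fP : exists s, pdom f = prefixes s.
  by exists (stutter_basis p t); rewrite fD pt stutter_basis_prefixes.
by exists (MkPath fP).
Qed.

Definition st p : Path A X := projT1 (cid (is_st_exists p)).

Lemma stP p : is_st p (st p).
Proof. exact: projT2 (cid (is_st_exists p)). Qed.

Lemma st_unique p q : is_st p q -> q = st p.
Proof.
have [dst est] := stP p; move=> [dq eq]; apply: path_ext => w.
have [|nq] := pselect (pdom q w).
  by rewrite dq => -[s ps <-]; rewrite eq // est.
have nst : ~ pdom (st p) w by rewrite dst -dq.
by move: nq nst; rewrite /pdom /=; case: (q w) (st p w) => [x|] [y|] // [].
Qed.

Definition stutter_equiv p q : bool := `[< st p = st q >].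

Lemma stutter_equiv_refl : reflexive stutter_equiv.
Proof. by move=> p; apply/asboolP. Qed.

Lemma stutter_equiv_sym : symmetric stutter_equiv.
Proof. by move=> p q; apply/asboolP/asboolP. Qed.

Lemma stutter_equiv_trans : transitive stutter_equiv.
Proof. by move=> q p r /asboolP e /asboolP f; apply/asboolP; rewrite e. Qed.

Canonical stutter_equiv_rel :=
  EquivRel stutter_equiv stutter_equiv_refl stutter_equiv_sym
    stutter_equiv_trans.

End Stutter.

Definition QPath (A X : Type) : Type := {eq_quot @stutter_equiv A X}.

Section QPathOrder.
Context (A X : Type).
Implicit Types u v w : QPath A X.

HB.instance Definition _ := Choice.on (QPath A X).
HB.instance Definition _ := EqQuotient.on (QPath A X).

Definition qpath_class (p : Path A X) : QPath A X := \pi_(QPath A X) p.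

Lemma qpath_classP (p q : Path A X) :
  qpath_class p = qpath_class q <-> st p = st q.
Proof. by split=> [/eqmodP/asboolP|e]//; apply/eqmodP/asboolP. Qed.

Definition qpath_le u v : bool := st (repr u) <= st (repr v).

Lemma qpath_class_repr u : qpath_class (repr u) = u.
Proof. exact: reprK. Qed.

Lemma st_repr_class (p : Path A X) : st (repr (qpath_class p)) = st p.
Proof. by apply/qpath_classP; rewrite qpath_class_repr. Qed.

Lemma qpath_le_refl : reflexive qpath_le.
Proof. by move=> u; exact: lexx. Qed.

Lemma qpath_le_anti : antisymmetric qpath_le.
Proof.
move=> u v /le_anti /qpath_classP.
by rewrite !qpath_class_repr.
Qed.

Lemma qpath_le_trans : transitive qpath_le.
Proof. by move=> v u w; exact: le_trans. Qed.

HB.instance Definition _ := Order.Le_isPOrder.Build path_display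
  (QPath A X) qpath_le_refl qpath_le_anti qpath_le_trans.

Lemma qpath_leE (p q : Path A X) :
  (qpath_class p <= qpath_class q) = (st p <= st q).
Proof. by rewrite -(st_repr_class p) -(st_repr_class q). Qed.

End QPathOrder.

(* Main.v *)
(* If [q] extends [p], the stutter basis of [q] satisfies on [dom p] the
   recursion that determines the basis of [p], because [dom p] is prefix-closed
   and [q] takes the same values there. So the two bases agree on [dom p] and
   [st q] extends [st p]. A monotone map pulls upward closed sets back to upward
   closed sets, i.e. it is continuous for the Alexandroff topologies. *)

Require Import Defs.
From mathcomp Require Import all_boot all_order.
From mathcomp Require Import boolp classical_sets topology_structure.
From mathcomp Require Import measurable_structure.

Local Open Scope classical_set_scope.
Local Open Scope order_scope.

Section StutterMonotone.
Context (A X : Type).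
Implicit Types (p q : Path A X) (s : word A).

Lemma pdom_rcons p s x : pdom p (rcons s x) -> pdom p s.
Proof.
by have [t ->] := path_domP p => -[u ->]; exists (x :: u); rewrite cat_rcons.
Qed.

Lemma stutter_basis_le p q s :
  p <= q -> pdom p s -> stutter_basis q s = stutter_basis p s.
Proof.
(* Uniqueness of the basis of [p] is used with [phi := stutter_basis q]. *)
move=> /path_leP[_ epq]; move: s; apply: stutter_basis_unique => //.
- move=> s ps e; apply: stutter_basis_tau_eq.
  by rewrite !epq //; exact: pdom_rcons ps.
- move=> s ps e; apply: stutter_basis_tau_neq.
  by rewrite !epq //; exact: pdom_rcons ps.
- by move=> s a _; exact: stutter_basis_act.
Qed.

Lemma st_le p q : p <= q -> st p <= st q.
Proof.
move=> lepq; have /path_leP[dpq epq] := lepq.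
have [[dp ep] [dq eq]] := (stP p, stP q).
apply/path_leP; split; rewrite dp ?dq => _ [s ps <-].
  by exists s; [exact: dpq|exact: stutter_basis_le].
(* Read as [stutter_basis q s], the word is one where [st q] is known: its value there is [q s],
   which is [p s]. *)
by rewrite ep // -(stutter_basis_le _ _ _ lepq ps) eq ?epq //; exact: dpq.
Qed.

Lemma qpath_class_le : {homo @qpath_class A X : p q / p <= q}.
Proof. by move=> p q /st_le; rewrite qpath_leE. Qed.

End StutterMonotone.

(** The sets with Borel preimage form a sigma-algebra; as it contains the open sets, it contains the
    Borel sets they generate. *)
Lemma borel_measurable_open (T U : topologicalType) (f : T -> U) :
  (forall B, open B -> open (f @^-1` B)) -> borel_measurable f.
Proof.
move=> fo B mB; rewrite -[f @^-1` B]setTI.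
suff: @borel U `<=` image_set_system setT f (@borel T) by exact.
apply: smallest_sub => [|C oC].
  exact/sigma_algebra_image/smallest_sigma_algebra.
by rewrite /image_set_system /= setTI; apply: sub_sigma_algebra; exact: fo.
Qed.

Lemma homo_borel_measurable d d' (P : porderType d) (Q : porderType d')
    (f : P -> Q) : {homo f : x y / x <= y} ->
  borel_measurable (f : alexandroff P -> alexandroff Q).
Proof.
move=> fh; apply: borel_measurable_open => B; rewrite !alexandroff_openE.
by move=> uB x y lexy; apply: uB; exact: fh.
Qed.

Theorem theorem27 (A X : Type) :
  {homo @qpath_class A X : p q / (p <= q)%O} /\
  borel_measurable
    (@qpath_class A X : alexandroff (Path A X) -> alexandroff (QPath A X)).
Proof.
split; first exact: qpath_class_le.
by apply: homo_borel_measurable; exact: qpath_class_le.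
Qed.
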